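(* Let $\Gamma=\langle\mathcal{A},\mathcal{R}\rangle$ be an AFRA. If $\mathcal{S}\subseteq\mathcal{A}\cup\mathcal{R}$ is conflict-free, then $\mathbb{F}_\Gamma(\mathcal{S})$ is also conflict-free.
   Context: An AFRA (Argumentation Framework with Recursive Attacks) is a pair $\langle\mathcal{A},\mathcal{R}\rangle$ where $\mathcal{A}$ is a set (of arguments) and $\mathcal{R}$ is a set of attacks, each attack being a pair $\alpha=(A,X)$ with $A\in\mathcal{A}$ and ($X\in\mathcal{R}$ or $X\in\mathcal{A}$); $A=src(\alpha)$ is its source and $X=trg(\alpha)$ its target. Arguments and attacks are distinct objects ($\mathcal{A}\cap\mathcal{R}=\emptyset$). Defeat: for $\alpha\in\mathcal{R}$, $V\in\mathcal{A}\cup\mathcal{R}$, $\alpha$ directly defeats $V$ iff $V=trg(\alpha)$; $\alpha$ indirectly defeats $\beta\in\mathcal{R}$ iff $\alpha$ directly defeats $src(\beta)$; $\alpha\rightarrow_R V$ ($\alpha$ defeats $V$) iff $\alpha$ directly or indirectly defeats $V$. Only attacks can defeat. A set $\mathcal{S}\subseteq\mathcal{A}\cup\mathcal{R}$ is conflict-free iff there are no $V,W\in\mathcal{S}$ with $V\rightarrow_R W$. $W\in\mathcal{A}\cup\mathcal{R}$ is acceptable w.r.t. $\mathcal{S}$ iff for every $\alpha\in\mathcal{R}$ with $\alpha\rightarrow_R W$ there is $\beta\in\mathcal{S}$ with $\beta\rightarrow_R\alpha$. The characteristic function $\mathbb{F}_\Gamma:2^{\mathcal{A}\cup\mathcal{R}}\to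 2^{\mathcal{A}\cup\mathcal{R}}$ is $\mathbb{F}_\Gamma(\mathcal{S})=\{V\mid V\text{ is acceptable w.r.t. }\mathcal{S}\}$. *)

(* Defs.v *)
From mathcomp Require Import all_boot classical_sets.

Set Implicit Arguments.
Unset Strict Implicit.
Unset Printing Implicit Defensive.

Local Open Scope classical_set_scope.

(* Argumentation Frameworks with Recursive Attacks, over possibly infinite sets
   of arguments and attacks.

   The sets A and R are represented by the carrier types [argument] and
   [attack]. The condition that every attack is a pair (a, X) with a in A and
   X in A or R becomes the map [attack_pair]; its injectivity says that an
   attack is nothing more than that pair. A map is needed because R occurs in
   its own definition. Well-foundedness of the recursion is not imposed. *)
Record AFRA := {
  argument : Type;
  attack : Type;
  attack_pair : attack -> argument * (argument + attack);
  attack_pair_inj : injective attack_pair }.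

(* The disjoint union of A and R: its two injections make arguments and attacks
   distinct objects. *)
Definition element (G : AFRA) : Type := (argument G + attack G)%type.

Definition src (G : AFRA) (alpha : attack G) : argument G :=
  (attack_pair alpha).1.

Definition trg (G : AFRA) (alpha : attack G) : element G :=
  (attack_pair alpha).2.

Definition directly_defeats (G : AFRA) (alpha : attack G) (V : element G) :
    Prop :=
  V = trg alpha.

Definition indirectly_defeats (G : AFRA) (alpha beta : attack G) : Prop :=
  directly_defeats alpha (inl (src beta)).

Definition attack_defeats (G : AFRA) (alpha : attack G) (V : element G) :
    Prop :=
  directly_defeats alpha V \/
  exists2 beta, V = inr beta & indirectly_defeats alpha beta.

(* Only attacks can defeat. *)
Definition defeats (G : AFRA) (V W : element G) : Prop :=
  exists2 alpha, V = inr alpha & attack_defeats alpha W.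

Definition conflict_free (G : AFRA) (S : set (element G)) : Prop :=
  ~ exists V W, [/\ S V, S W & defeats V W].

Definition acceptable (G : AFRA) (S : set (element G)) (W : element G) : Prop :=
  forall alpha : attack G, defeats (inr alpha) W ->
    exists2 beta, S beta & defeats beta (inr alpha).

Definition characteristic (G : AFRA) (S : set (element G)) : set (element G) :=
  [set V | acceptable S V].

(* Main.v *)
Require Import Defs.
From mathcomp Require Import all_boot classical_sets.

(** A conflict between acceptable elements pushes back into [S]: if [V] defeats [W], then [S]
    defends [W] by some [B] defeating [V], and in turn defends [V] by some [C] defeating [B]. Both
    [B] and [C] lie in [S]. *)

Theorem proposition2 (G : AFRA) (S : set (element G)) :
  conflict_free S -> conflict_free (characteristic S).
Proof.
move=> cfS [V [W [accV accW VW]]]; apply: cfS.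
have [alpha defV _] := VW; rewrite {}defV in accV VW.
have [B SB B_alpha] := accW alpha VW.
(* Acceptability of [V] only answers attacks, so the defender [B] must first be exposed as an attack
   [beta]. *)
have [beta defB _] := B_alpha; rewrite {}defB in SB B_alpha.
have [C SC C_beta] := accV beta B_alpha.
by exists C, (inr beta).
Qed.
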